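(* There exists $c>0$ such that for every integer $0\le d<c\sqrt n/\log n$, if $G$ is an $n$-vertex graph with minimum degree $\delta(G)\ge n/2+d$, then $G$ is $(d+1)$-rigid.
   Context: A graph $G=(V,E)$ with at least $D+1$ vertices is $D$-rigid if there is an embedding $\mathbf p:V\to\mathbb R^D$ whose rigidity matrix (rows indexed by edges, $D$ columns per vertex, row of $\{u,v\}$ equal to $\mathbf p(u)-\mathbf p(v)$ at $u$, $\mathbf p(v)-\mathbf p(u)$ at $v$, zero elsewhere) has rank $D|V|-\binom{D+1}{2}$. Logarithms are natural. *)

(* Defs.v *)
From mathcomp Require Import all_boot all_order all_algebra.
From mathcomp Require Import reals.

Set Implicit Arguments.
Unset Strict Implicit.
Unset Printing Implicit Defensive.

Import Order.TTheory GRing.Theory Num.Theory.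

Local Open Scope ring_scope.

Record sgraph (V : finType) := SGraph {
  adj :> rel V;
  adj_sym : symmetric adj;
  adj_irrefl : irreflexive adj }.

Definition edges (V : finType) (G : sgraph V) : {set {set V}} :=
  [set [set x.1; x.2] | x in [pred x : V * V | G x.1 x.2]].

Definition degree (V : finType) (G : sgraph V) (v : V) : nat :=
  #|[set w | G v w]|.

(* Every degree is smaller than #|V|, so the default value #|V| only matters
   when V is empty. *)
Definition min_degree (V : finType) (G : sgraph V) : nat :=
  \big[minn/#|V|]_(v : V) degree G v.

(* Rows are indexed by the edges, columns by the pairs (vertex, coordinate).
   For an edge e containing w, the sum below ranges over the single endpoint
   of e other than w. *)
Definition rigidity_mx (R : realType) (V : finType) (G : sgraph V) (D : nat)
    (p : V -> 'rV[R]_D) : 'M[R]_(#|edges G|, #|{: V * 'I_D}|) :=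
  \matrix_(a < #|edges G|, b < #|{: V * 'I_D}|)
    let e : {set V} := enum_val a in
    let: (w, i) := enum_val b : V * 'I_D in
    if w \in e then \sum_(v in e :\ w) (p w - p v) 0 i else 0.

(* The natural subtraction does not truncate: #|V| >= D + 1 forces
   D * #|V| >= 'C(D.+1, 2). *)
Definition rigid (R : realType) (D : nat) (V : finType) (G : sgraph V) : Prop :=
  (D.+1 <= #|V|)%N /\
  exists p : V -> 'rV[R]_D,
    injective p /\ \rank (rigidity_mx G p) = (D * #|V| - 'C(D.+1, 2))%N.

(* Main.v *)
(* A colouring of V by D = d + 1 colours such that every class, and every bipartite
   graph between two classes, is connected makes G D-rigid: put the vertex v of
   colour i on the i-th axis, at a point close to e_i. In the limit a bar inside
   the class i has direction e_i and a bar between the classes i and j has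
   direction e_i - e_j, so connectivity leaves only the isometries in the kernel.

   Such a colouring is found at random. Two vertices of the same colour with many
   common neighbours are connected through each class. If this does not link all
   vertices, then V splits into two halves and G is close either to two disjoint
   cliques or to a complete bipartite graph on them; a random colouring then
   leaves at most two components in each required graph, and one edge of the
   sparse kind is needed for every pair of colours. The degree bound provides
   such edges at each vertex of a half: d + 1 across the halves in the first case,
   d inside a half in the second. Colouring O(D^2 log n) vertices in advance
   ("senders") makes these edges meet all pairs of colours. *)

Require Import Defs.
From mathcomp Require Import all_boot all_order all_algebra.
From mathcomp Require Import reals exp zify ring lra.

Set Implicit Arguments.
Unset Strict Implicit.
Unset Printing Implicit Defensive.

Import Order.TTheory GRing.Theory Num.Theory.

(** * Random colourings and senders *)

Lemma subset_of_card (T : finType) (A : {set T}) k :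
  k <= #|A| -> exists2 B : {set T}, B \subset A & #|B| = k.
Proof.
move=> kA; exists [set x in take k (enum A)].
  by apply/subsetP => x; rewrite inE => /mem_take; rewrite mem_enum.
rewrite cardsE; have /card_uniqP -> := take_uniq k (enum_uniq A).
by rewrite size_takel // -cardE.
Qed.

Lemma double_count (T : finType) (H : rel T) (A B : {set T}) :
  \sum_(x in A) #|[set y in B | H x y]| = \sum_(y in B) #|[set x in A | H x y]|.
Proof.
under eq_bigr => x _ do rewrite -sum1dep_card big_mkcondr.
rewrite exchange_big; apply: eq_bigr => y yB.
by rewrite -sum1dep_card big_mkcondr.
Qed.

Section Matching.
Variables (V : finType) (H : rel V) (T Z : {set V}) (rho Delta : nat).
Hypothesis Hsym : symmetric H.
Hypothesis Hirr : irreflexive H.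
Hypothesis light : forall v, v \notin T -> #|[set w | H v w]| <= Delta.
Hypothesis ZT : [disjoint Z & T].
Hypothesis deg : forall z, z \in Z -> rho <= #|[set w in ~: T | H z w]|.

Definition is_matching (s : seq (V * V)) :=
  [/\ uniq (unzip1 s ++ unzip2 s), {subset unzip1 s <= Z},
      {subset unzip2 s <= ~: T} & {in s, forall e, H e.1 e.2}].

Lemma exists_matching m : 0 < rho ->
  (forall k, k < m -> 2 * k * Delta + 2 * k * rho < #|Z| * rho) ->
  exists2 s, is_matching s & size s = m.
Proof.
move=> rho0; elim: m => [_|m IH bound]; first by exists [::].
have [|s [us s1 s2 sH] sz] := IH; first by move=> k km; apply: bound; lia.
pose U := [set x in unzip1 s ++ unzip2 s].
have cU : #|U| = 2 * m.
  by rewrite cardsE (card_uniqP us) size_cat !size_map sz mul2n addnn.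
have [/existsP[x /existsP[y]]|none] :=
    boolP [exists x, exists y, [&& x \in Z :\: U, y \in ~: T :\: U & H x y]].
  rewrite !inE mem_cat => /and3P[/andP[xU xZ] /andP[yU yT] xy].
  have [xU1 xU2] : x \notin unzip1 s /\ x \notin unzip2 s.
    by move: xU; rewrite ?mem_cat negb_or => /andP.
  have [yU1 yU2] : y \notin unzip1 s /\ y \notin unzip2 s.
    by move: yU; rewrite ?mem_cat negb_or => /andP.
  exists ((x, y) :: s); last by rewrite /= sz.
  split=> /=.
  - rewrite mem_cat inE !negb_or xU1 xU2 /=.
    rewrite (uniq_catCA _ [:: y]) /= mem_cat negb_or yU1 yU2 us !andbT.
    by apply: contraTneq xy => ->; rewrite Hirr.
  - by move=> z; rewrite inE => /predU1P[-> //|/s1].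
  - by move=> z; rewrite inE => /predU1P[->|/s2 //]; rewrite inE.
  - by move=> e; rewrite inE => /predU1P[-> //|/sH].
exfalso; have noH x y : x \in Z :\: U -> y \in ~: T :\: U -> ~~ H x y.
  move=> xZ yT; apply: contra none => xy.
  by apply/existsP; exists x; apply/existsP; exists y; rewrite xZ yT.
have low : #|Z :\: U| * rho <= \sum_(x in Z :\: U) #|[set y in U :\: T | H x y]|.
  rewrite -sum_nat_const; apply: leq_sum => x xZ.
  have /setDP[xZ1 _] := xZ; apply: leq_trans (deg xZ1) _.
  apply/subset_leq_card/subsetP => y; rewrite !inE => /andP[yT xy].
  rewrite xy yT !andbT; apply: contraLR xy => yU; apply: noH => //.
  by rewrite !inE yU.
have up : \sum_(x in Z :\: U) #|[set y in U :\: T | H x y]| <= 2 * m * Delta.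
  rewrite double_count -cU.
  apply: (@leq_trans (#|U :\: T| * Delta)); last first.
    by rewrite leq_mul2r subset_leq_card ?subsetDl ?orbT.
  rewrite -sum_nat_const; apply: leq_sum => y; rewrite !inE => /andP[yT _].
  apply: leq_trans (light yT); apply/subset_leq_card/subsetP => x.
  by rewrite !inE => /andP[_]; rewrite Hsym.
have ZU : #|Z| <= #|Z :\: U| + 2 * m.
  by rewrite -cU -(cardsID U Z) addnC leq_add2l subset_leq_card ?subsetIr.
have := bound m (leqnn _); have := leq_mul ZU (leqnn rho).
by rewrite mulnDl; lia.
Qed.

End Matching.

Section Senders.
Variables (V : finType) (H : rel V) (S : {set V}) (r K : nat).
Hypothesis Hsym : symmetric H.
Hypothesis Hirr : irreflexive H.
Hypothesis rK : r <= K.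
Hypothesis S_large : 8 * K ^ 2 <= #|S|.
Hypothesis deg : forall s, s \in S -> r <= #|[set y | H s y]|.

Definition receivers (Y : {set V}) (chi : V -> nat) i :=
  [set y | (y \notin Y) && [exists x in Y, (chi x == i) && H x y]].

(* The vertices of [Y] get the first [r] colours in advance and the others are
   coloured later. A vertex of large degree serves as the single sender of its
   colour; [K] of its neighbours are kept out of [Y]. If fewer than [r] vertices
   have large degree, then the edges avoiding them contain a matching large
   enough to give each remaining colour [K] senders. *)
Lemma exists_senders : exists (Y : {set V}) (chi : V -> nat),
  [/\ #|Y| <= r * K, {in Y, forall v, chi v < r} &
      forall i, i < r -> K <= #|receivers Y chi i|].
Proof.
case: (posnP r) => [r0|r_gt0].
  by exists set0, (fun=> 0); split=> [|v|i]; rewrite ?cards0 ?inE ?r0.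
have K0 : 0 < K by lia.
pose N v := [set w | H v w].
pose T := [set v | K + r <= #|N v|].
have [rT|Tr] := leqP r #|T|.
  have [T0 T0T cT0] := subset_of_card rT.
  exists T0, (index^~ (enum T0)); split.
  - by rewrite cT0 leq_pmulr.
  - by move=> v vT; rewrite -cT0 cardE index_mem mem_enum.
  move=> i ir.
  have [v0 _] : exists v, v \in T0 by apply/card_gt0P; rewrite cT0.
  have sz : i < size (enum T0) by rewrite -cardE cT0.
  have cT : nth v0 (enum T0) i \in T0 by rewrite -mem_enum mem_nth.
  have := subsetP T0T _ cT; rewrite inE => hc.
  have : K <= #|N (nth v0 (enum T0) i) :\: T0|.
    by have := cardsID T0 (N (nth v0 (enum T0) i));
      have := subset_leq_card (subsetIr (N (nth v0 (enum T0) i)) T0); lia.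
  move/leq_trans; apply; apply/subset_leq_card/subsetP => y.
  rewrite !inE => /andP[-> xy] /=; apply/exists_inP; exists (nth v0 (enum T0) i) => //.
  by rewrite index_uniq ?enum_uniq ?eqxx.
set t := #|T| in Tr *.
(* Each heavy vertex reserves [K] receivers outside [T]; excluding them from [Z] below keeps them
   from becoming senders. *)
have heavyP c : exists R : {set V}, c \in T -> [/\ R \subset N c, [disjoint R & T] & #|R| = K].
  have [cT|_] := boolP (c \in T); last by exists set0.
  have hK : K <= #|N c :\: T|.
    move: cT; rewrite inE => h; have := cardsID T (N c).
    by have := subset_leq_card (subsetIr (N c) T); rewrite -/t; lia.
  have [R RN cR] := subset_of_card hK; exists R => _; split=> //.
    by apply: subset_trans RN (subsetDl _ _).
  by move: RN; rewrite subsetD => /andP[].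
have [Rc RcP] := fin_all_exists heavyP.
pose R := \bigcup_(c in T) Rc c.
have cR : #|R| <= t * K.
  rewrite /R /t -sum_nat_const.
  elim/big_rec2: _ => [|c m A cT IH]; first by rewrite cards0.
  by apply: leq_trans (leq_card_setU _ _) _; rewrite leq_add //; have [_ _ ->] := RcP _ cT.
pose Z := S :\: (T :|: R).
have ZT : [disjoint Z & T].
  by rewrite disjoints_subset; apply/subsetP => x; rewrite !inE negb_or => /andP[/andP[]].
have ZR : [disjoint Z & R].
  rewrite disjoints_subset; apply/subsetP => x; rewrite in_setD in_setU negb_or in_setC.
  by case/andP=> /andP[].
have light v : v \notin T -> #|[set w | H v w]| <= K + r.
  by rewrite inE -ltnNge => /ltnW.
have degZ z : z \in Z -> r - t <= #|[set w in ~: T | H z w]|.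
  rewrite inE => /andP[_ /deg]; have := cardsID T (N z); rewrite -/(N z).
  have := subset_leq_card (subsetIr (N z) T); rewrite -/t.
  have -> : #|[set w in ~: T | H z w]| = #|N z :\: T|.
    by apply: eq_card => w; rewrite !inE.
  lia.
have cZ : #|S| <= #|Z| + t + t * K.
  have := cardsID (T :|: R) S; rewrite -/Z.
  have := subset_leq_card (subsetIr S (T :|: R)); have := leq_of_leqif (leq_card_setU T R).
  by rewrite -/t; lia.
have bnd k : k < (r - t) * K -> 2 * k * (K + r) + 2 * k * (r - t) < #|Z| * (r - t).
  move=> kb.
  have Zbig : 2 * K * (K + r + (r - t)) <= #|Z|.
    have : K * r <= K * K by rewrite leq_mul2l rK orbT.
    have : K * (r - t) <= K * K by rewrite leq_mul2l; lia.
    have : t * K <= K * K by rewrite leq_mul2r; lia.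
    have : t <= t * K by rewrite leq_pmulr.
    by move: S_large cZ; rewrite expnS expn1 -mulnA !mulnDr; lia.
  have : 2 * k * (K + r + (r - t)) < 2 * ((r - t) * K) * (K + r + (r - t)).
    by rewrite ltn_pmul2r; lia.
  have := leq_mul Zbig (leqnn (r - t)); nia.
have rt : 0 < r - t by lia.
have [s [us s1 s2 sH] sz] := exists_matching Hsym Hirr light ZT degZ rt bnd.
pose X1 := [set x in unzip1 s].
have X1Z : X1 \subset Z by apply/subsetP => x; rewrite inE => /s1.
have X1T x : x \in X1 -> x \notin T.
  by move=> /(subsetP X1Z) xZ; apply/negP => xT; have /pred0P/(_ x) := ZT; rewrite /= xZ xT.
have szu : size (unzip1 s) = (r - t) * K by rewrite size_map.
(* The heavy vertices take the first [t] colours. The matching is cut into blocks of [K] edges, one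
   block per remaining colour; first endpoints send, second endpoints receive. *)
pose chi v := if v \in T then index v (enum T) else t + index v (unzip1 s) %/ K.
exists (T :|: X1), chi; split.
- apply: leq_trans (leq_card_setU _ _) _; rewrite -/t.
  have h : #|X1| <= (r - t) * K by rewrite cardsE -szu card_size.
  have : t <= t * K by rewrite leq_pmulr.
  have : t * K + (r - t) * K = r * K by rewrite -mulnDl subnKC // ltnW.
  lia.
- move=> v; rewrite /chi; case: ifP => [vT _|vT].
    by rewrite (leq_trans _ Tr) // ltnS ltnW // /t cardE index_mem mem_enum.
  rewrite in_setU vT inE -index_mem szu => /= h.
  have : index v (unzip1 s) %/ K < r - t by rewrite ltn_divLR.
  lia.
move=> i ir; have [it|ti] := ltnP i t.
  have [v0 _] : exists v, v \in T by apply/card_gt0P; rewrite -/t; lia.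
  set c := nth v0 (enum T) i.
  have szi : i < size (enum T) by rewrite -cardE.
  have cT : c \in T by rewrite -mem_enum mem_nth.
  have [RN RT <-] := RcP _ cT.
  apply/subset_leq_card/subsetP => y yR.
  have yT : y \notin T by apply/negP => yT; have /pred0P/(_ y) := RT; rewrite /= yR yT.
  have yX : y \notin X1.
    apply/negP => /(subsetP X1Z) yZ; have /pred0P/(_ y) := ZR; rewrite /= yZ /=.
    by move/negbT/bigcupP; apply; exists c.
  rewrite inE in_setU (negPf yT) yX /=; apply/exists_inP; exists c.
    by rewrite in_setU cT.
  rewrite /chi cT index_uniq ?enum_uniq // eqxx /=.
  by have := subsetP RN _ yR; rewrite inE.
have [e0 _] : exists e, e \in s.
  by case: s sz {us s1 s2 sH X1 X1Z X1T szu chi} => [/=|e s _]; [nia|exists e; rewrite mem_head].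
pose pos (k : 'I_K) := (i - t) * K + k.
have posS k : pos k < size s.
  have := ltn_ord k; have : (i - t).+1 * K <= (r - t) * K by rewrite leq_mul2r; lia.
  by rewrite sz /pos mulSn; lia.
pose g (k : 'I_K) := (nth e0 s (pos k)).2.
have uu := us; rewrite cat_uniq in uu; have [u1 /hasPn u12 u2] := and3P uu.
have ginj : injective g.
  move=> k l; rewrite /g -!(nth_map e0 e0.2 snd) ?posS // => /eqP.
  rewrite nth_uniq ?size_map ?posS // => /eqP h.
  by apply: val_inj; rewrite /pos in h; apply/eqP; rewrite -(eqn_add2l ((i - t) * K)) h.
rewrite -[K]card_ord -(card_imset _ ginj).
apply/subset_leq_card/subsetP => _ /imsetP[k _ ->].
have es : nth e0 s (pos k) \in s by rewrite mem_nth.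
set e := nth e0 s (pos k) in es *.
have e1 : e.1 \in unzip1 s by apply: map_f.
have e2 : g k \in unzip2 s by rewrite /g -/e; apply: map_f.
have eT : e.1 \notin T by apply: X1T; rewrite inE.
rewrite inE in_setU negb_or [g k \in X1]inE u12 // andbT.
have := s2 _ e2; rewrite inE => -> /=.
apply/exists_inP; exists e.1; first by rewrite in_setU [_ \in X1]inE e1 orbT.
rewrite sH // andbT /chi (negPf eT).
have -> : index e.1 (unzip1 s) = pos k.
  by rewrite /e -(nth_map e0 e0.1 fst) // index_uniq // size_map.
by rewrite /pos divnMDl // divn_small // addn0 subnKC.
Qed.

End Senders.

Section Colouring.
Variables (V I : finType) (D L : nat) (Y : {set V}) (chi : V -> 'I_D).
Variable F : I -> {set V}.

(** The first two terms of the binomial expansion of the right side suffice. *)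
Lemma double_pred_exp m : 2 * m ^ m.+1 <= m.+1 ^ m.+1.
Proof.
rewrite -(addn1 m) expnDn big_ord_recl addn1 big_ord_recl /=.
rewrite !exp1n !muln1 bin0 mul1n /bump /= addn0 bin1 subn0 subSS subn0.
have : m ^ m.+1 <= m.+1 * m ^ m by rewrite expnS leq_mul.
lia.
Qed.

(** A uniform colouring of [a] vertices misses a given colour with probability [(1 - 1/D)^a]; this
    bounds it by [2^-L], without division. *)
Lemma pred_exp_bound a : 0 < D -> D * L <= a -> 2 ^ L * D.-1 ^ a <= D ^ a.
Proof.
case: D => // m _ /subnKC <-; rewrite !(expnD _ (m.+1 * L)) mulnA leq_mul //.
  rewrite !(expnM _ m.+1 L) -(expnMn 2).
  by case: L => [//|l]; rewrite leq_exp2r // double_pred_exp.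
by case: (_ - _) => [//|l]; rewrite leq_exp2r.
Qed.

Lemma card_family_prod (T : finType) (Q : V -> pred T) :
  #|family Q| = \prod_(v : V) #|Q v|.
Proof. by rewrite card_family foldrE big_map big_enum. Qed.

(** Union bound by counting: among the colourings that extend [chi] from [Y], those where a large
    [F k] misses colour [j] outside [Y] make up at most a [2^-L] share, and there are at most
    [#|I| * D] such pairs. *)
Lemma colouring : #|I| * D < 2 ^ L ->
  exists f : V -> 'I_D, {in Y, f =1 chi} /\
    forall k j, D * L <= #|F k :\: Y| -> exists2 v, v \in F k :\: Y & f v = j.
Proof.
move=> IL.
pose Q v : pred 'I_D := if v \in Y then pred1 (chi v) else predT.
pose Bad k j v : pred 'I_D :=
  if v \in Y then pred1 (chi v) else if v \in F k then predC1 j else predT.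
pose b := #|~: Y|.
have cQ : #|family Q| = D ^ b.
  rewrite card_family_prod (bigID (mem Y)) /= big1 ?mul1n; last first.
    by move=> v vY; rewrite /Q vY card1.
  under eq_bigr => v vY do rewrite /Q (negPf vY) card_ord.
  by rewrite prod_nat_const; congr (_ ^ _); apply: eq_card => v; rewrite !inE.
have cB k j : D * L <= #|F k :\: Y| -> 2 ^ L * #|family (Bad k j)| <= D ^ b.
  move=> hk; rewrite card_family_prod (bigID (mem Y)) /= big1 ?mul1n; last first.
    by move=> v vY; rewrite /Bad vY card1.
  rewrite (bigID (mem (F k))) /=.
  under eq_bigr => v /andP[vY vF].
    rewrite /Bad (negPf vY) vF cardC1 card_ord; over.
  under [X in _ * (_ * X)]eq_bigr => v /andP[vY vF].
    rewrite /Bad (negPf vY) (negPf vF) card_ord; over.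
  rewrite !prod_nat_const.
  rewrite mulnA.
  have -> : #|[pred v | v \notin Y & v \in F k]| = #|F k :\: Y|.
    by apply: eq_card => v; rewrite !inE.
  have -> : #|[pred v | v \notin Y & v \notin F k]| = #|~: Y :\: F k|.
    by apply: eq_card => v; rewrite !inE andbC.
  have -> : b = #|F k :\: Y| + #|~: Y :\: F k|.
    by rewrite /b -(cardsID (F k) (~: Y)) setIC -setDE.
  by rewrite expnD leq_mul // pred_exp_bound // (leq_ltn_trans _ (ltn_ord j)).
case: (pickP [pred f in family Q | [forall k, forall j,
    (D * L <= #|F k :\: Y|) ==> (f \notin family (Bad k j))]]) => [f|none].
  case/andP=> fQ /forallP fB; exists f; split.
    by move=> v vY; have /familyP/(_ v) := fQ; rewrite /Q vY => /eqP.
  move=> k j hk; have /forallP/(_ j) := fB k; rewrite hk /=.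
  move=> nfam; suff /exists_inP[v vF /eqP fv] : [exists v in F k :\: Y, f v == j].
    by exists v.
  apply: contraR nfam => nex.
  apply/familyP => v; have /familyP/(_ v) := fQ; rewrite /Q /Bad.
  case: ifP => // vY _; case: ifP => // vF; rewrite !inE.
  apply: contraNN nex => fv; apply/exists_inP; exists v => //.
  by rewrite !inE vY.
have sub : family Q \subset
    \bigcup_(kj : I * 'I_D | D * L <= #|F kj.1 :\: Y|) [set f in family (Bad kj.1 kj.2)].
  apply/subsetP=> f fQ; have := none f; rewrite /= fQ /=.
  move/negbT; rewrite negb_forall => /existsP[k]; rewrite negb_forall => /existsP[j].
  rewrite negb_imply negbK => /andP[hk fb].
  by apply/bigcupP; exists (k, j) => //; rewrite in_set.
have : 2 ^ L * D ^ b <= #|I| * D * D ^ b.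
  rewrite -cQ; apply: leq_trans (leq_mul (leqnn _) (subset_leq_card sub)) _.
  apply: (@leq_trans (2 ^ L * \sum_(kj : I * 'I_D | D * L <= #|F kj.1 :\: Y|) #|family (Bad kj.1 kj.2)|)).
    rewrite leq_mul //; elim/big_rec2: _ => [|kj m S _ IH]; first by rewrite cards0.
    by apply: leq_trans (leq_card_setU _ _) _; rewrite cardsE leq_add.
  rewrite big_distrr /=; apply: leq_trans (leq_sum _ (fun kj h => cB kj.1 kj.2 h)) _.
  rewrite sum_nat_const cQ leq_mul // (leq_trans (max_card _)) //.
  by rewrite card_prod card_ord.
(* For [D = 0] the map [chi] forces [V] to be empty, and the power is [0 ^ 0 = 1]. *)
have D0 : 0 < D ^ b.
  rewrite expn_gt0; case: (posnP D) => // D0; rewrite /b /= cards_eq0.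
  apply/eqP/setP => v; rewrite !inE.
  by have := ltn_ord (chi v); rewrite {2}D0.
by rewrite leq_pmul2r // leqNgt IL.
Qed.

End Colouring.

(** * Strong rigid partitions of dense graphs *)

(** For [i = j] this is the graph induced on the class [i], so connectivity of a class and between
    two classes is a single condition. *)
Definition link (V : finType) D (G : rel V) (f : V -> 'I_D) i j : rel V :=
  [rel u v | G u v && ((f u == i) && (f v == j) || (f u == j) && (f v == i))].

Definition strong_rigid_partition (V : finType) D (G : rel V) (f : V -> 'I_D) :=
  (forall i, exists v, f v = i) /\
  forall i j u v, (f u == i) || (f u == j) -> (f v == i) || (f v == j) ->
    connect (link G f i j) u v.

Lemma linkC (V : finType) D (G : rel V) (f : V -> 'I_D) i j :
  link G f i j =2 link G f j i.
Proof. by move=> u v; rewrite /link /= orbC. Qed.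

Lemma link_connectC (V : finType) D (G : sgraph V) (f : V -> 'I_D) i j :
  connect_sym (link G f i j).
Proof.
apply: sym_connect_sym => u v; rewrite /link /= adj_sym; congr (_ && _).
by rewrite orbC; congr (_ || _); exact: andbC.
Qed.

Definition nbrs (V : finType) (G : rel V) u := [set w | G u w].

Definition common (V : finType) (G : rel V) u v := nbrs G u :&: nbrs G v.

(** A middle vertex with the colour of [u] and [v] will link them by a path of length four whose
    other inner vertices are common neighbours in any wanted class. *)
Definition mids (V : finType) (G : rel V) T u v :=
  [set w | (T <= #|common G u w|) && (T <= #|common G w v|)].

Lemma commonC (V : finType) (G : rel V) u v : common G u v = common G v u.
Proof. exact: setIC. Qed.

Section LinkedColouring.
Variables (V I : finType) (G : sgraph V) (D L T : nat) (Y : {set V}).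
Variables (chi : V -> 'I_D) (F : I -> {set V}).
Hypothesis YT : #|Y| + D * L <= T.
Hypothesis L_large : (2 * #|V| ^ 2 + #|I|) * D < 2 ^ L.

(** The random colouring is applied to all common neighbourhoods and all middle sets along with [F];
    a set of size [T] keeps [D * L] vertices outside [Y]. *)
Lemma linked_colouring : exists f : V -> 'I_D,
  [/\ {in Y, f =1 chi},
      forall u v, T <= #|common G u v| -> forall j, exists w, [/\ G u w, G v w & f w = j],
      forall i j u v, T <= #|common G u v| \/ T <= #|mids G T u v| ->
        f u = f v -> (f u == i) || (f u == j) -> connect (link G f i j) u v &
      forall k j, D * L <= #|F k :\: Y| -> exists2 v, v \in F k :\: Y & f v = j].
Proof.
pose FF (k : V * V + V * V + I) := match k with
  | inl (inl (u, v)) => common G u v | inl (inr (u, v)) => mids G T u v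
  | inr k => F k end.
have [|f [fY hits]] := @colouring V _ D L Y chi FF.
  by rewrite !card_sum !card_prod addnn -mul2n mulnn.
have big (S : {set V}) : T <= #|S| -> D * L <= #|S :\: Y|.
  by have := cardsID Y S; have := subset_leq_card (subsetIr S Y); lia.
have nbr u v : T <= #|common G u v| -> forall j, exists w, [/\ G u w, G v w & f w = j].
  move=> huv j; have [w] := hits (inl (inl (u, v))) j (big _ huv).
  by rewrite !inE => /and3P[_ uw vw] fw; exists w.
have direct i j u v : T <= #|common G u v| -> f u = f v -> (f u == i) || (f u == j) ->
    connect (link G f i j) u v.
  move=> huv fuv; case/orP=> /eqP fu.
    have [w [uw vw fw]] := nbr _ _ huv j.
    apply: (@connect_trans _ _ w); apply: connect1; rewrite /link /= ?uw ?fu ?fw ?eqxx //.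
    by rewrite adj_sym vw -fuv fu !eqxx orbT.
  have [w [uw vw fw]] := nbr _ _ huv i.
  apply: (@connect_trans _ _ w); apply: connect1; rewrite /link /= ?uw ?fu ?fw ?eqxx ?orbT //.
  by rewrite adj_sym vw -fuv fu !eqxx.
exists f; split=> //; last by move=> k j hk; have [v] := hits (inr k) j hk; exists v.
move=> i j u v [huv|huv] fuv fu; first exact: direct.
have [w] := hits (inl (inr (u, v))) (f u) (big _ huv).
rewrite !inE => /and3P[_ uw wv] fw.
by apply: connect_trans (direct _ _ _ _ uw _ _) (direct _ _ _ _ wv _ _); rewrite ?fw.
Qed.

End LinkedColouring.

(* [twist] tells whether the many edges known to exist run across the two sides;
   one edge of the other kind per pair of colours then connects everything. *)
Section Merge.
Variables (V : finType) (G : sgraph V) (D : nat) (f : V -> 'I_D).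
Variables (side : V -> bool) (twist : bool).
Hypothesis sideP : forall (i j : 'I_D) u v, side u = side v -> f u = f v ->
  (f u == i) || (f u == j) -> connect (link G f i j) u v.
Hypothesis straight : forall s i j, exists x z,
  [/\ G x z, side x = s, side z = s (+) twist, f x = i & f z = j].
Hypothesis across : forall i j : 'I_D, i <= j -> (twist -> i != j) -> exists x z,
  [/\ G x z, side z = side x (+) ~~ twist, f x = i & f z = j].

(** For fixed colours [i] and [j], [sideP] shrinks the vertices of one side and one colour to a
    point [rep s k]. Straight edges pair [(s, i)] with [(s (+) twist, j)], and an edge from [across]
    joins the two pairs. If [twist] holds and [i = j], a straight edge already joins both points. *)
Lemma merge_sides : strong_rigid_partition G f.
Proof.
have ex s i : exists v, side v = s /\ f v = i.
  by have [x [_ [_ ? _ ? _]]] := straight s i i; exists x.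
split=> [i|]; first by have [v [_ <-]] := ex true i; exists v.
suff main (i j : 'I_D) u v : i <= j -> (f u == i) || (f u == j) -> (f v == i) || (f v == j) ->
    connect (link G f i j) u v.
  move=> i j u v; have [ij|/ltnW ji] := leqP i j; first exact: main.
  rewrite (eq_connect (linkC G f i j)) ![_ || (_ == j)]orbC; exact: main.
move=> ij; pose c := connect (link G f i j).
have cT y x z : c x y -> c y z -> c x z by apply: connect_trans.
have cC x y : c x y = c y x by apply: link_connectC.
have [a [sa fa]] := ex true i; have [a' [sa' fa']] := ex true j.
have [b [sb fb]] := ex false i; have [b' [sb' fb']] := ex false j.
pose rep s k := if s then (if k == i then a else a') else (if k == i then b else b').
have repP s k : (k == i) || (k == j) -> side (rep s k) = s /\ f (rep s k) = k.
  by rewrite /rep; case: eqP => [->|_ /eqP->]; case: s.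
have to_rep w : (f w == i) || (f w == j) -> c w (rep (side w) (f w)).
  by move=> fw; have [? ?] := repP (side w) _ fw; apply: sideP.
have edge x z : G x z -> f x = i -> f z = j -> c (rep (side x) i) (rep (side z) j).
  move=> xz fx fz; have := @to_rep x; have := @to_rep z.
  rewrite fx fz !eqxx orbT => /(_ isT) cz /(_ isT) cx.
  have xz' : c x z by apply: connect1; rewrite /link /= xz fx fz !eqxx.
  by rewrite cC in cx; apply: (cT _ _ _ cx (cT _ _ _ xz' cz)).
have st s : c (rep s i) (rep (s (+) twist) j).
  by have [x [z [xz <- <- fx fz]]] := straight s i j; apply: edge.
have cr s : (twist -> i != j) -> c (rep s i) (rep (s (+) ~~ twist) j) \/
    c (rep (~~ s) i) (rep (~~ s (+) ~~ twist) j).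
  move=> h; have [x [z [xz sz fx fz]]] := across ij h.
  have := edge _ _ xz fx fz; rewrite sz.
  by case: (side x) s => -[]; [left|right|right|left].
have hub s k : (k == i) || (k == j) -> c (rep s k) (rep true i).
  have [tij|] := boolP (twist && (i == j)).
    case/andP: tij => tw /eqP ije; have := st true; rewrite tw -ije /= => h.
    by rewrite orbb => /eqP->; case: s; [exact: connect0 | rewrite cC].
  rewrite negb_and -implybE => /implyP h.
  have [zi tj fj] : [/\ c (rep true i) (rep false i),
      c (rep true i) (rep (true (+) twist) j) & c (rep true i) (rep (false (+) twist) j)].
    have ht := st true; have hf := st false.
    case: (cr true h) => hc.
      have hc' : c (rep true i) (rep (false (+) twist) j) by move: hc; case: (twist).
      by split=> //; rewrite cC in hf; apply: (cT _ _ _ hc' hf).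
    have hc' : c (rep (true (+) twist) j) (rep false i) by rewrite cC; move: hc; case: (twist).
    by split=> //; [apply: (cT _ _ _ ht hc')|apply: (cT _ _ _ ht (cT _ _ _ hc' hf))].
  by rewrite cC => /orP[]/eqP->; move: tj fj; case: (twist); case: s => // *; exact: connect0.
move=> fu fv; have h1 := cT _ _ _ (to_rep u fu) (hub _ _ fu).
have h2 := cT _ _ _ (to_rep v fv) (hub _ _ fv); rewrite cC in h2; by apply: (cT _ _ _ h1 h2).
Qed.

End Merge.

(** * Neighbourhoods around a pair with few common neighbours *)

Section FarPair.
Variables (V : finType) (G : sgraph V) (n T : nat).
Local Notation N := (nbrs G).
Hypothesis cardV : #|V| = n.
Hypothesis deg : forall x, n <= 2 * #|N x|.

Lemma card_addC (A : {set V}) : #|A| + #|~: A| = n.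
Proof. by rewrite cardsC. Qed.

Lemma card_nbrsC x : 2 * #|~: N x| <= n.
Proof. by have := card_addC (N x); have := deg x; lia. Qed.

(** [N x] has at least [n / 2] vertices, nearly all in [~: N v], which has at most [n / 2]. *)
Lemma far_nbrs v x : #|common G x v| < T -> #|~: N v :\: N x| <= T.
Proof.
have := card_nbrsC v; have := deg x; have := cardsID (N v) (N x).
have := cardsID (N x) (~: N v); rewrite setIC -setDE /common; lia.
Qed.

(** [N u] and [N v] cover all but [T] vertices, and [N x] nearly avoids [N v]. *)
Lemma far_nbrs_other u v x :
  #|common G u v| < T -> #|common G x v| < T -> #|N x :\: N u| < 2 * T.
Proof.
rewrite /common => huv hxv.
have hPQ : #|~: (N u :|: N v)| < T.
  have := card_addC (N u :|: N v); have := cardsUI (N u) (N v).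
  by have := deg u; have := deg v; lia.
have sub : N x :\: N u \subset (N x :&: N v) :|: ~: (N u :|: N v).
  by apply/subsetP => w; rewrite !inE; case: (G u w); case: (G x w); case: (G v w).
have := subset_leq_card sub; have := leq_of_leqif (leq_card_setU (N x :&: N v) (~: (N u :|: N v))).
by lia.
Qed.

Lemma near_nbrs u v x : #|common G u v| < T ->
  #|N x :\: N u| <= #|N x :\: N v| -> n <= 4 * #|N x :\: N v| + 2 * T.
Proof.
move=> huv hx.
have sub : N x \subset (N x :\: N u) :|: (N x :\: N v) :|: common G u v.
  by apply/subsetP => w; rewrite !inE; case: (G u w); case: (G x w); case: (G v w).
have := subset_leq_card sub.
have := leq_of_leqif (leq_card_setU (N x :\: N u :|: N x :\: N v) (common G u v)).
have := leq_of_leqif (leq_card_setU (N x :\: N u) (N x :\: N v)).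
by have := deg x; lia.
Qed.

(** About a quarter of all vertices lie in [N x] outside [N v], and [N y] contains nearly everything
    outside [N v]. *)
Lemma near_far_common u v x y : 100 * T <= n -> #|common G u v| < T ->
  #|N x :\: N u| <= #|N x :\: N v| -> #|common G y v| < T -> T <= #|common G x y|.
Proof.
move=> T_small huv hx hy; have := near_nbrs huv hx; have := far_nbrs hy.
have sub : N x :\: N v \subset common G x y :|: (~: N v :\: N y).
  by apply/subsetP => w; rewrite !inE; case: (G y w); case: (G x w); case: (G v w).
have := subset_leq_card sub.
have := leq_of_leqif (leq_card_setU (common G x y) (~: N v :\: N y)).
by lia.
Qed.

(** A vertex outside [A0] and [B0] is a middle vertex, so a small [A0] makes [B0] nearly all of [V].
    Then about [n / 2] vertices outside [N v] have about [n / 2] neighbours each in [B0], while a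
    vertex of [B0] has at most [2 * T] neighbours outside [N v]. *)
Lemma far_large u v : 100 * T <= n -> 0 < T -> #|common G u v| < T -> #|mids G T u v| < T ->
  2 * T <= #|[set x | #|common G x v| < T]|.
Proof.
move=> T_small T0 huv hm; set A0 := [set x | _]; pose B0 := [set y | #|common G y u| < T].
rewrite leqNgt; apply/negP => small.
have cB : #|~: B0| < 3 * T.
  have sub : ~: B0 \subset A0 :|: mids G T u v.
    apply/subsetP => x; rewrite !inE -leqNgt => h; rewrite [common G u x]commonC h /=.
    by rewrite ltnNge orNb.
  have := subset_leq_card sub; have := leq_of_leqif (leq_card_setU A0 (mids G T u v)); lia.
have := double_count G (~: N v) B0.
have : \sum_(y in B0) #|[set x in ~: N v | G x y]| <= n * (2 * T).
  apply: (@leq_trans (#|B0| * (2 * T))); last by rewrite leq_mul2r -cardV max_card orbT.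
  rewrite -sum_nat_const; apply: leq_sum => y; rewrite inE => yB.
  rewrite commonC in huv; apply: leq_trans (ltnW (far_nbrs_other huv yB)).
  by apply/subset_leq_card/subsetP => w; rewrite !inE [G w y]adj_sym.
have : #|~: N v| * (n - 6 * T) <= 2 * \sum_(x in ~: N v) #|[set y in B0 | G x y]|.
  rewrite big_distrr -sum_nat_const /=; apply: leq_sum => x _.
  have -> : #|[set y in B0 | G x y]| = #|N x :\: ~: B0|.
    by apply: eq_card => y; rewrite !inE negbK.
  have := cardsID (~: B0) (N x); have := subset_leq_card (subsetIr (N x) (~: B0)).
  by have := deg x; lia.
move=> lo up dc; rewrite dc in lo.
have cP : n <= 2 * #|~: N v| + 2 * T.
  have := card_nbrsC u; have := card_addC (N v); have := cardsUI (N u) (N v).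
  have := card_addC (N u); have := card_addC (N u :|: N v).
  by move: huv; rewrite /common; lia.
have : (n - 2 * T) * (n - 6 * T) <= 2 * #|~: N v| * (n - 6 * T).
  by rewrite leq_mul2r; lia.
have : 90 * T * n <= (n - 2 * T) * (n - 6 * T) by nia.
by nia.
Qed.

End FarPair.

Section DensePartition.
Variables (V : finType) (G : sgraph V) (n d L : nat).
Let D := d.+1.
Let K := D * L.
(** Room for at most [D * K <= K ^ 2] senders and the [D * L] vertices that a set needs to receive
    every colour. *)
Let T := 2 * K ^ 2.
Local Notation N := (nbrs G).
Hypothesis cardV : #|V| = n.
Hypothesis n_gt0 : 0 < n.
Hypothesis L_large : 4 * n ^ 2 * D < 2 ^ L.
Hypothesis n_large : 200 * K ^ 2 <= n.
Hypothesis min_deg : forall v, n + 2 * d <= 2 * #|N v|.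

Let T_small : 100 * T <= n. Proof. by rewrite mulnA. Qed.

Let deg v : n <= 2 * #|N v|. Proof. by have := min_deg v; lia. Qed.

Let L_gt2 : 2 < L.
Proof.
rewrite ltnNge; apply/negP => L2.
have : 2 ^ L <= 2 ^ 2 by rewrite leq_exp2l.
move: L_large; rewrite /D mulnS -mulnA; nia.
Qed.

Let D_leK : D <= K. Proof. by rewrite leq_pmulr //; lia. Qed.

Let T_gt0 : 0 < T. Proof. by rewrite muln_gt0 expn_gt0 muln_gt0 /=; lia. Qed.

Let K_leT m : m <= D -> m * K + K <= T.
Proof.
move=> mD; have : m * K <= K * K by rewrite leq_mul2r; lia.
have : K <= K * K by rewrite leq_pmulr //; lia.
by rewrite /T expnS expn1; lia.
Qed.

(* Each colour class meets every middle set [mids G T u v], so it is connected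
   through common neighbours in any class. *)
Lemma partition_of_linked :
  (forall u v, T <= #|common G u v| \/ T <= #|mids G T u v|) ->
  exists f : V -> 'I_D, strong_rigid_partition G f.
Proof.
move=> linked; have [||f [_ hits conn _]] :=
    @linked_colouring V void G D L T set0 (fun=> ord0) (fun=> set0).
- by rewrite cards0; have := K_leT (leq0n D); lia.
- rewrite card_void addn0 cardV (leq_ltn_trans _ L_large) //.
  by rewrite leq_mul2r leq_mul2r orbT.
have self v : T <= #|common G v v|.
  by rewrite /common setIid; have := deg v; lia.
exists f; split=> [i|i j u v fu fv].
  have [v _] : exists v, v \in V by apply/card_gt0P; rewrite cardV.
  by have [w [_ _ fw]] := hits v v (self v) i; exists w.
have [w [vw _ fw]] := hits v v (self v) (f u).
apply: (@connect_trans _ _ w); first exact: conn.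
have [fuv|fuv] := eqVneq (f u) (f v); first by apply: conn; rewrite ?fw.
apply: connect1; rewrite /link /= adj_sym vw fw.
by case/orP: fu fv fuv => /eqP-> /orP[]/eqP->; rewrite !eqxx ?orbT.
Qed.

Section Far.
Variables u v : V.
Hypothesis far_uv : #|common G u v| < T.
Hypothesis few_mids : #|mids G T u v| < T.

Let far_vu : #|common G v u| < T. Proof. by rewrite commonC. Qed.
Let few_mids' : #|mids G T v u| < T.
Proof.
suff -> : mids G T v u = mids G T u v by [].
by apply/setP => w; rewrite !inE andbC [common G w u]commonC [common G v w]commonC.
Qed.

(** Up to O([T]) vertices, [N u] and [N v] partition [V]; vertices are sorted by which of the two
    their neighbourhood resembles more. The cores hold the extreme vertices, adjacent to nearly all
    of [P] or of [Q]. *)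
Let side x := #|N x :\: N u| <= #|N x :\: N v|.
Let core s := [set x | #|common G x (if s then v else u)| < T].
Let half s := [set x | side x == s].
Let P := ~: N v.
Let Q := ~: N u.

(* [twist] holds when [G] looks like a complete bipartite graph between the two
   halves; otherwise it looks like the disjoint union of two cliques. *)
Let twist := (2 * T <= #|P :\: half true|) || (2 * T <= #|Q :\: half false|).

Let core_large s : 2 * T <= #|core s|.
Proof.
case: s; first exact: (far_large cardV deg T_small T_gt0 far_uv few_mids).
exact: (far_large cardV deg T_small T_gt0 far_vu few_mids').
Qed.

Let core_common s x y : side x = s -> y \in core s -> T <= #|common G x y|.
Proof.
rewrite /side inE; case: s => hs.
  exact: (near_far_common cardV deg T_small far_uv).
by apply: (near_far_common cardV deg T_small far_vu); apply: ltnW; rewrite ltnNge hs.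
Qed.

Let core_side s x : x \in core s -> side x = s.
Proof.
rewrite /side inE; case: s => hx.
  have := far_nbrs_other cardV deg far_uv hx.
  have := cardsID (N v) (N x); have := deg x; move: hx; rewrite /common; lia.
have := far_nbrs_other cardV deg far_vu hx.
have := cardsID (N u) (N x); have := deg x; move: hx; rewrite /common => *.
by apply/negbTE; rewrite -ltnNge; lia.
Qed.

(** Every core vertex of the common side is a middle vertex. *)
Let same_side_mids x y : side x = side y -> T <= #|mids G T x y|.
Proof.
move=> sxy; apply: leq_trans (leq_trans (core_large (side x)) _); first by lia.
apply/subset_leq_card/subsetP => z zc; rewrite inE (core_common (erefl _) zc) /=.
by rewrite commonC; apply: core_common zc.
Qed.

Let halfE s : half (~~ s) = ~: half s.
Proof. by apply/setP => x; rewrite !inE; case: (side x) s => -[]. Qed.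

Let card_PQ s : n <= 2 * #|if s then P else Q| + 2 * T.
Proof.
have := card_nbrsC cardV deg u; have := card_nbrsC cardV deg v.
have := cardsUI (N u) (N v); have := card_addC cardV (N u :|: N v).
have := card_addC cardV (N u); have := card_addC cardV (N v).
by rewrite /P /Q; move: far_uv; rewrite /common; case: s; lia.
Qed.

Let core_nbrs s x : x \in core s -> #|(if s then P else Q) :\: N x| <= T.
Proof. by rewrite inE; case: s => hx; apply: (far_nbrs cardV deg hx). Qed.

Let core_nbrs_half s0 s x : x \in core s0 ->
  2 * T <= #|(if s0 then P else Q) :&: half s| -> T <= #|N x :&: half s|.
Proof.
move=> /core_nbrs; set W := if s0 then P else Q => h1 h2.
have sub : W :&: half s \subset (N x :&: half s) :|: (W :\: N x).
  by apply/subsetP => w; rewrite !inE => /andP[-> ->]; rewrite !andbT orbN.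
have := subset_leq_card sub; have := leq_of_leqif (leq_card_setU (N x :&: half s) (W :\: N x)).
by lia.
Qed.

Let joins s0 s1 := forall x, x \in core s0 -> T <= #|N x :&: half s1|.

Let twisted : twist -> exists s, joins s (~~ s).
Proof.
by case/orP=> h; [exists true|exists false] => x xc; apply: (core_nbrs_half xc);
  rewrite halfE -setDE.
Qed.

(** Here [P] and [Q], of about [n / 2] vertices each, lie in their own halves up to O([T])
    vertices. *)
Let untwisted : ~~ twist -> (forall s, joins s s) /\ (forall s, n <= 2 * #|half s| + 6 * T).
Proof.
rewrite negb_or -!ltnNge => /andP[hP hQ]; split=> s.
  move=> x xc; apply: (core_nbrs_half xc); have := card_PQ s.
  by case: s xc => _; [have := cardsID (half true) P|have := cardsID (half false) Q]; lia.
have := card_PQ s; case: s.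
  have := cardsID (half true) P; have := subset_leq_card (subsetIr P (half true)); lia.
have := cardsID (half false) Q; have := subset_leq_card (subsetIr Q (half false)); lia.
Qed.

(* The edges of the sparse kind: inside the halves in the bipartite case, across
   in the case of two cliques. *)
Let H : rel V := [rel x y | G x y && (side y == side x (+) ~~ twist)].

Let H_sym : symmetric H.
Proof.
by move=> x y; rewrite /H /= adj_sym; congr (_ && _); case: (side x) (side y) twist => -[] -[].
Qed.

Let H_irr : irreflexive H. Proof. by move=> x; rewrite /H /= adj_irrefl. Qed.

(** The half with guaranteed sparse edges. In the bipartite case it is the larger one, as the other
    half absorbs at most [n / 2] neighbours; in the case of two cliques it is the smaller one, which
    absorbs at most [n / 2 - 1]. *)
Let s0 := (#|half false| <= #|half true|) (+) ~~ twist.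

Let half_half : #|half true| + #|half false| = n.
Proof. by rewrite (halfE true) (card_addC cardV). Qed.

Let half_s0_large : 8 * K ^ 2 <= #|half s0|.
Proof.
have -> : 8 * K ^ 2 = 4 * T by rewrite /T mulnA.
have := half_half; rewrite /s0; have [/twisted _|/untwisted[_ hs]] := boolP twist.
  by rewrite addbF; case: (leqP #|half false| #|half true|); lia.
by have := hs (~~ (#|half false| <= #|half true|)); rewrite addbT; lia.
Qed.

Let deg_H x : x \in half s0 -> D - twist <= #|[set y | H x y]|.
Proof.
rewrite inE => /eqP sx; have hh := half_half; have := min_deg x.
have [tw|tw] := boolP twist.
  have -> : [set y | H x y] = N x :&: half s0.
    by apply/setP => y; rewrite !inE /H /= tw sx addbF.
  have := cardsID (half s0) (N x); have := subset_leq_card (subsetDr (N x) (half s0)).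
  by rewrite -halfE /s0 tw addbF /D; case: (leqP #|half false| #|half true|) => /=; lia.
have -> : [set y | H x y] = N x :\: half s0.
  by apply/setP => y; rewrite !inE /H /= (negPf tw) sx addbT andbC; congr (_ && _); case: (side y) s0 => -[].
have := cardsID (half s0) (N x).
(* That [x] is not its own neighbour turns [d] into [d + 1]. *)
have : N x :&: half s0 \proper half s0.
  apply/properP; split; first exact: subsetIr.
  by exists x; rewrite !inE ?sx // adj_irrefl.
move/proper_card; move: sx => _.
by rewrite /s0 (negPf tw) addbT /D; case: (leqP #|half false| #|half true|) => /=; lia.
Qed.

Lemma partition_of_far : exists f : V -> 'I_D, strong_rigid_partition G f.
Proof.
have rK : D - twist <= K by lia.
have [Y [chi [cY chiD rec]]] := exists_senders H_sym H_irr rK half_s0_large deg_H.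
(* Cores and neighbourhoods within a half yield the straight edges, receivers the edges across. *)
pose F (k : V * bool + bool + 'I_D) := match k with
  | inl (inl (x, s)) => N x :&: half s
  | inl (inr s) => core s
  | inr i => receivers H Y chi i end.
have YT : #|Y| + D * L <= T.
  apply: leq_trans (K_leT (leq_subr twist D)); rewrite leq_add //.
have [//||f [fY _ conn hits]] := @linked_colouring V _ G D L T Y (fun x => inord (chi x)) F.
  rewrite !card_sum card_prod card_bool card_ord cardV (leq_ltn_trans _ L_large) //.
  rewrite leq_mul2r; apply/orP; right.
  have : K <= K * K by rewrite leq_pmulr //; lia.
  by move: n_large; rewrite !expnS expn0 !muln1; nia.
have hitT k : T <= #|F k| -> forall j, exists2 w, w \in F k & f w = j.
  move=> hk j; have [|w] := hits k j.
    by have := cardsID Y (F k); have := subset_leq_card (subsetIr (F k) Y); lia.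
  by case/setDP=> wF _ fw; exists w.
have core_link a b : joins a b -> forall i j, exists x z,
    [/\ G x z, side x = a, side z = b, f x = i & f z = j].
  move=> ab i j; have [|x /= xc fx] := hitT (inl (inr a)) _ i.
    by apply: leq_trans (core_large a); lia.
  have [|z /= zN fz] := hitT (inl (inl (x, b))) _ j; first exact: ab.
  move: zN; rewrite !inE => /andP[xz /eqP sz].
  by exists x, z; split=> //; apply: core_side.
exists f; apply: (merge_sides (side := side) (twist := twist)).
- by move=> i j x y sxy fxy fx; apply: conn => //; right; apply: same_side_mids.
- move=> s i j; have [/twisted[a ab]|/untwisted[ab _]] := boolP twist.
    have [sa|sa] := eqVneq s a.
      have [x [z [xz sx sz fx fz]]] := core_link _ _ ab i j.
      by exists x, z; split=> //; rewrite ?sz ?sx ?sa ?addbT.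
    (* Only the core of side [a] is known to send edges over, so an edge with the colours exchanged
       is read backwards. *)
    have [x [z [xz sx sz fx fz]]] := core_link _ _ ab j i.
    exists z, x; rewrite adj_sym; split=> //.
      by rewrite sz; case: s a sa {ab sx sz} => -[].
    by rewrite sx addbT; case: s a sa {ab sx sz} => -[].
  have [x [z [xz sx sz fx fz]]] := core_link _ _ (ab s) i j.
  by exists x, z; rewrite addbF.
move=> i j ij tij.
(* Senders carry the smaller colour of a pair; in the twisted case [i < j], so [d] sender colours
   suffice. *)
have ir : i < D - twist.
  move: tij; case: twist => [/(_ isT) nij|_]; last by rewrite subn0.
  have : i < j by rewrite ltn_neqAle nij.
  by have := ltn_ord j; lia.
have [|z zF fz] := hits (inr i) j.
  have -> : F (inr i) :\: Y = receivers H Y chi i; last exact: rec.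
  by apply/setP => y; rewrite /F in_setD andb_idl // inE => /andP[].
case/setDP: zF; rewrite /F inE => /andP[_ /exists_inP[x xY /andP[/eqP cx]]].
rewrite /H /= => /andP[xz /eqP sz] _; exists x, z; split=> //.
by rewrite fY // cx inord_val.
Qed.

End Far.

Theorem dense_partition : exists f : V -> 'I_D, strong_rigid_partition G f.
Proof.
have [/existsP[u /existsP[v /andP[]]]|none] := boolP [exists u, exists v,
    (#|common G u v| < T) && (#|mids G T u v| < T)]; first exact: partition_of_far.
apply: partition_of_linked => u v; move: none; rewrite negb_exists => /forallP/(_ u).
rewrite negb_exists => /forallP/(_ v); rewrite negb_and -!leqNgt.
by case/orP; [left|right].
Qed.

End DensePartition.

Lemma min_degree_le (V : finType) (G : sgraph V) v : min_degree G <= #|nbrs G v|.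
Proof.
have aux (s : seq V) m : v \in s -> \big[minn/m]_(w <- s) degree G w <= degree G v.
  elim: s => // w s IH; rewrite inE big_cons => /predU1P[->|/IH]; first exact: geq_minl.
  exact: leq_trans (geq_minr _ _).
exact/aux/mem_index_enum.
Qed.

(** The case [d = 0], where [n] may be too small for the random argument. Nonadjacent vertices
    without common neighbours would have [n] neighbours among [n - 2] vertices. *)
Lemma dense_partition1 (V : finType) (G : sgraph V) :
  0 < #|V| -> (forall v, #|V| <= 2 * #|nbrs G v|) ->
  strong_rigid_partition G (fun _ : V => ord0 : 'I_1).
Proof.
move=> /card_gt0P[v0 _] deg; split=> [i|i j u v _ _]; first by exists v0; rewrite [i]ord1.
rewrite (@eq_connect _ _ G); last first.
  by move=> x y; rewrite /link /= [i]ord1 [j]ord1 !eqxx orbT andbT.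
have [->|uv] := eqVneq u v; first exact: connect0.
have [Guv|nGuv] := boolP (G u v); first exact: connect1.
have [w|none] := pickP [pred w in common G u v].
  rewrite /= !inE => /andP[uw vw].
  by apply: (@connect_trans _ _ w); apply: connect1; rewrite // adj_sym.
have common0 : #|common G u v| = 0 by apply: eq_card0.
have sub : nbrs G u :|: nbrs G v \subset ~: [set u; v].
  apply/subsetP => w; rewrite !inE.
  by apply: contraTN => /orP[]/eqP->; rewrite !adj_irrefl ?(negPf nGuv) // adj_sym (negPf nGuv).
have := subset_leq_card sub; have := cardsC [set u; v]; rewrite cards2 uv.
have := cardsUI (nbrs G u) (nbrs G v); rewrite -/(common G u v) common0.
by have := deg u; have := deg v; lia.
Qed.

Local Open Scope ring_scope.

(** * Rigidity from strong rigid partitions *)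

Lemma connect_invariant (T : finType) (S : Type) (e : rel T) (g : T -> S) x y :
  (forall a b, e a b -> g a = g b) -> connect e x y -> g x = g y.
Proof.
move=> eg /connectP[p ep ->] {y}.
by elim: p x ep => [|z p IH] x //= /andP[/eg -> /IH].
Qed.

Lemma col_inj_rank (F : fieldType) N c (W : 'M[F]_(N, c)) :
  (forall u : 'cV_c, W *m u = 0 -> u = 0) -> \rank W = c.
Proof.
move=> inj; rewrite -mxrank_tr; apply/eqP; apply: inj_row_free => v /(congr1 trmx).
by rewrite trmx_mul trmxK trmx0 => /inj /(congr1 trmx); rewrite trmxK trmx0.
Qed.

Section Tests.
Variables (F : fieldType) (m N c : nat) (M : 'M[F]_(m, N)) (E : 'M[F]_(c, N)).
Hypothesis inj : forall u : 'cV_N, M *m u = 0 -> E *m u = 0 -> u = 0.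

Lemma rank_col_mx_tests : \rank (col_mx M E) = N.
Proof.
apply: col_inj_rank => u; rewrite mul_col_mx -[0]vsubmxK => /eq_col_mx[].
by rewrite !linear0; apply: inj.
Qed.

Lemma rank_of_tests : (N <= \rank M + c)%N.
Proof.
rewrite -{1}rank_col_mx_tests -addsmxE (leq_trans (leq_of_leqif (mxrank_adds_leqif _ _))) //.
by rewrite leq_add2l rank_leq_row.
Qed.

End Tests.

Section BarMatrix.
Variables (V : finType) (G : sgraph V) (D : nat).
Local Notation N := #|{: V * 'I_D}|.

(* A rigidity matrix whose row of [{u, v}] is [q u v] at [u] and [q v u] at [v]. *)
Definition bar_mx (S : nzRingType) (q : V -> V -> 'I_D -> S) : 'M[S]_(#|edges G|, N) :=
  \matrix_(a, b)
    let e : {set V} := enum_val a in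
    let: (w, i) := enum_val b : V * 'I_D in
    if w \in e then \sum_(v in e :\ w) q w v i else 0.

Definition motion (S : nzRingType) (u : 'cV[S]_N) w i : S := u (enum_rank (w, i)) 0.

Lemma motion_eq0 (S : nzRingType) (u : 'cV[S]_N) : (forall w i, motion u w i = 0) -> u = 0.
Proof.
move=> u0; apply/matrixP => b o; rewrite ord1 !mxE -[b]enum_valK.
by case: (enum_val b) => w i; apply: u0.
Qed.

Lemma map_bar_mx (S S' : nzRingType) (h : {rmorphism S -> S'}) q :
  map_mx h (bar_mx q) = bar_mx (fun x y i => h (q x y i)).
Proof.
apply/matrixP => a b; rewrite !mxE; case: (enum_val b) => w i.
by rewrite /=; case: ifP => _; rewrite ?rmorph0 ?rmorph_sum.
Qed.

Lemma sum_motion (S : nzRingType) (g : 'I_N -> S) :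
  \sum_b g b = \sum_(w : V) \sum_(i < D) g (enum_rank (w, i)).
Proof.
rewrite pair_bigA /= (reindex enum_rank) /=; first by apply: eq_bigr => -[].
by exists enum_val => x _; rewrite ?enum_rankK ?enum_valK.
Qed.

Lemma bar_mx_row (S : nzRingType) q (u : 'cV[S]_N) a x y :
  enum_val a = [set x; y] -> x != y ->
  (bar_mx q *m u) a 0 = \sum_(i < D) (q x y i * motion u x i + q y x i * motion u y i).
Proof.
move=> ea xy; have yx : y != x by rewrite eq_sym.
rewrite mxE sum_motion (bigD1 x) // (bigD1 y) //= [X in _ + (_ + X)]big1 ?addr0; last first.
  move=> w /andP[wx wy]; apply: big1 => i _.
  by rewrite mxE enum_rankK /= ea !inE (negPf wx) (negPf wy) mul0r.
rewrite -big_split; apply: eq_bigr => i _ /=; rewrite !mxE !enum_rankK /= ea !inE !eqxx orbT /=.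
have -> : [set x; y] :\ x = [set y].
  by apply/setP => z; rewrite !inE; case: eqVneq => // ->; rewrite (negPf xy).
have -> : [set x; y] :\ y = [set x].
  apply/setP => z; rewrite !inE; case: (eqVneq z y) => [->|]; first by rewrite (negPf yx).
  by rewrite orbF.
by rewrite !big_set1.
Qed.

Lemma bar_mx_kernel (S : nzRingType) q (u : 'cV[S]_N) :
  bar_mx q *m u = 0 <->
  forall x y, G x y -> \sum_(i < D) (q x y i * motion u x i + q y x i * motion u y i) = 0.
Proof.
split=> [qu x y xy|qu].
  have xe : [set x; y] \in edges G by apply/imsetP; exists (x, y).
  rewrite -(@bar_mx_row _ q u (enum_rank_in xe [set x; y])) ?qu ?mxE //.
    by rewrite enum_rankK_in.
  by apply: contraTneq xy => ->; rewrite adj_irrefl.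
apply/matrixP => a o; rewrite ord1 [RHS]mxE.
have /imsetP[[x y] /= xy ea] := enum_valP a.
rewrite inE /= in xy; rewrite (bar_mx_row _ _ ea) ?qu //.
by apply: contraTneq xy => ->; rewrite adj_irrefl.
Qed.

End BarMatrix.

Definition upper D (ij : 'I_D * 'I_D) := (ij.1 <= ij.2)%N.

Lemma card_upper D : #|{: {ij : 'I_D * 'I_D | upper ij}}| = 'C(D.+1, 2).
Proof.
rewrite card_sig -sum1_card -(pair_big_dep xpredT (fun i j : 'I_D => i <= j)%N (fun _ _ => 1%N)) /=.
rewrite (exchange_big_dep xpredT) //= -bin2_sum big_mkord big_ord_recl add0n.
apply: eq_bigr => j _; rewrite sum1dep_card -[RHS]card_ord.
have inj : injective (widen_ord (ltn_ord j)) by move=> k l /(congr1 val) kl; apply: val_inj.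
rewrite -[RHS]cardsT -(card_imset _ inj) /=.
apply: eq_card => i; rewrite !inE; apply/idP/imsetP => [ij|[k _ ->]].
  by exists (Ordinal (ij : i < j.+1)%N) => //; apply: val_inj.
by rewrite -ltnS /=.
Qed.

Lemma exists_nat_nonroot (R : numDomainType) (P : {poly R}) :
  P != 0 -> exists k : nat, ~~ root P k.+1%:R.
Proof.
move=> P0; have [all_roots|] := boolP (all (root P) [seq k.+1%:R | k <- iota 0 (size P)]).
  have := max_poly_roots P0 all_roots; rewrite size_map size_iota ltnn.
  by rewrite map_inj_uniq ?iota_uniq => [/(_ isT)//|i j /eqP]; rewrite eqr_nat eqSS => /eqP.
by case/allPn => [_ /mapP[k _ ->]]; exists k.
Qed.

Lemma sum_pick (R : pzSemiRingType) D (g : 'I_D -> R) k : \sum_i (i == k)%:R * g i = g k.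
Proof. by rewrite (bigD1 k) //= eqxx mul1r big1 ?addr0 // => i /negPf->; rewrite mul0r. Qed.

Section StrongPartitionRigid.
Variables (R : realType) (V : finType) (G : sgraph V) (D : nat) (f : V -> 'I_D).
Hypothesis f_strong : strong_rigid_partition G f.
Local Notation N := #|{: V * 'I_D}|.
Local Notation pairs := {ij : 'I_D * 'I_D | upper ij}.

Variable rep : 'I_D -> V.
Hypothesis f_rep : forall i, f (rep i) = i.

Let label (v : V) : R := (enum_rank v)%:R.

(** Coordinate [j] of the representative of class [i] is pinned for [i <= j], one test per
    infinitesimal isometry. *)
Definition test_mx (S : nzRingType) : 'M[S]_(#|{: pairs}|, N) :=
  \matrix_(k, b) (b == enum_rank (rep (val (enum_val k)).1, (val (enum_val k)).2))%:R.

Lemma test_mxE (S : nzRingType) (u : 'cV[S]_N) (ij : pairs) :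
  (test_mx S *m u) (enum_rank ij) 0 = motion u (rep (val ij).1) (val ij).2.
Proof.
rewrite mxE (bigD1 (enum_rank (rep (val ij).1, (val ij).2))) //=.
rewrite mxE enum_rankK eqxx mul1r big1 ?addr0 // => b hb.
by rewrite mxE enum_rankK (negPf hb) mul0r.
Qed.

(* Bars of the placement [v |-> (1 + eps * label v) e_(f v)], those inside a
   class being divided by [eps]; this makes sense also for [eps = 0]. *)
Definition bar (S : nzRingType) (eps : S) (lab : V -> S) x y i : S :=
  if f x == f y then (lab x - lab y) * (i == f x)%:R
  else (1 + eps * lab x) * (i == f x)%:R - (1 + eps * lab y) * (i == f y)%:R.

(** Coordinate [i] is constant on class [i], and the difference of coordinates [i] and [j] is
    constant on the union of both classes; the tests at the representatives make these constants
    zero. *)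
Lemma bar_mx0_inj (u : 'cV[R]_N) :
  bar_mx G (bar 0 label) *m u = 0 -> test_mx R *m u = 0 -> u = 0.
Proof.
move=> /bar_mx_kernel ker tests.
have test0 (i j : 'I_D) : (i <= j)%N -> motion u (rep i) j = 0.
  by move=> ij; have := test_mxE u (Sub (i, j) ij); rewrite tests mxE /= => <-.
have stress i j x y : f x = i -> f y = j -> G x y ->
    if i == j then motion u x i = motion u y i
    else motion u x i - motion u x j = motion u y i - motion u y j.
  move=> fx fy xy; have := ker x y xy; rewrite /bar fx fy [j == i]eq_sym.
  case: eqP => [ij|nij].
    move=> h; have : (label x - label y) * (motion u x i - motion u y i) = 0.
      rewrite -{}h -(sum_pick (motion u x) i) -(sum_pick (motion u y) i) -sumrB mulr_sumr.
      by apply: eq_bigr => k _; rewrite -ij; ring.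
    move/eqP; rewrite mulf_eq0 !subr_eq0 => /orP[|/eqP //].
    rewrite eqr_nat => /eqP /val_inj /enum_rank_inj xx.
    by move: xy; rewrite xx adj_irrefl.
  move=> h; apply/eqP; rewrite -subr_eq0 -[X in _ == X]h; apply/eqP.
  rewrite -(sum_pick (motion u x) i) -(sum_pick (motion u x) j).
  rewrite -(sum_pick (motion u y) i) -(sum_pick (motion u y) j) -!sumrB.
  by apply: eq_bigr => k _; ring.
have const i w : f w = i -> motion u w i = 0.
  move=> fw; rewrite -(test0 i i (leqnn _)).
  apply: (@connect_invariant _ _ (link G f i i) (fun v => motion u v i)); last first.
    by apply: f_strong.2; rewrite ?fw ?f_rep eqxx.
  move=> x y /andP[xy]; rewrite orbb => /andP[/eqP fx /eqP fy].
  by have := stress i i x y fx fy xy; rewrite eqxx.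
have diff (i j : 'I_D) w : (i < j)%N -> (f w == i) || (f w == j) -> motion u w i = motion u w j.
  move=> ij fw; apply/eqP; rewrite -subr_eq0; apply/eqP.
  have nij : i != j by apply: contraTneq ij => ->; rewrite ltnn.
  rewrite -(subrr (0 : R)) -{1}(test0 i i (leqnn _)) -(test0 i j (ltnW ij)).
  apply: (@connect_invariant _ _ (link G f i j) (fun v => motion u v i - motion u v j)).
    move=> x y /andP[xy /orP[]/andP[/eqP fx /eqP fy]].
      by have := stress i j x y fx fy xy; rewrite (negPf nij).
    have := stress j i x y fx fy xy; rewrite eq_sym (negPf nij) => h.
    by rewrite -[LHS]opprB -[RHS]opprB h.
  by apply: f_strong.2 => //; rewrite f_rep eqxx.
apply: motion_eq0 => w i; have [fwi|ifw|fwi] := ltngtP (f w) i.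
- by rewrite -(diff (f w) i) ?eqxx // const.
- by rewrite (diff i (f w)) ?eqxx ?orbT // const.
by apply: const; apply: val_inj.
Qed.

(** With [eps] as an indeterminate, a maximal minor that is nonzero at [0] is a nonzero polynomial;
    a positive integer that is not a root serves as [eps]. *)
Lemma bar_mx_inj : exists2 eps : R, 0 < eps & forall u : 'cV[R]_N,
  bar_mx G (bar eps label) *m u = 0 -> test_mx R *m u = 0 -> u = 0.
Proof.
pose A : 'M[{poly R}]_(_, N) := col_mx (bar_mx G (bar 'X (fun v => (label v)%:P))) (test_mx _).
have evalA eps : map_mx (horner_eval eps) A = col_mx (bar_mx G (bar eps label)) (test_mx R).
  rewrite map_col_mx map_bar_mx; congr col_mx; apply/matrixP => a b.
    rewrite !mxE; case: (enum_val b) => w i /=; case: ifP => // _.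
    apply: eq_bigr => v _; rewrite /bar /horner_eval; case: ifP => _.
      by rewrite !hornerE /=; case: (i == _); rewrite ?hornerE.
    by case: (i == f w); case: (i == f v); rewrite !hornerE.
  by rewrite !mxE; case: (b == _); rewrite /horner_eval hornerE.
have full : row_full (map_mx (horner_eval 0) A).
  by rewrite /row_full evalA; apply/eqP/rank_col_mx_tests/bar_mx0_inj.
pose g := fullrankfun full.
have minor eps : \det (rowsub g (map_mx (horner_eval eps) A)) = (\det (rowsub g A)).[eps].
  by rewrite -[RHS]/(horner_eval eps _) -det_map_mx map_mxsub.
have [|k] := @exists_nat_nonroot R (\det (rowsub g A)).
  have := fullrowsub_unit full; rewrite unitmxE minor unitfE.
  by apply: contraNneq => ->; rewrite horner0.
rewrite /root -minor -unitfE -unitmxE => unit_k.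
exists k.+1%:R; first by rewrite ltr0n.
move=> u bu tu; have Au : map_mx (horner_eval k.+1%:R) A *m u = 0.
  by rewrite evalA mul_col_mx bu tu col_mx0.
have : rowsub g (map_mx (horner_eval k.+1%:R) A) *m u = 0.
  by rewrite mul_rowsub_mx Au; apply/matrixP => a b; rewrite !mxE.
by move/(congr1 (mulmx (invmx (rowsub g (map_mx (horner_eval k.+1%:R) A)))));
  rewrite mulKmx // mulmx0.
Qed.

Definition placement (eps : R) v : 'rV[R]_D := \row_i ((1 + eps * label v) * (i == f v)%:R).

Let rigidity_mxE (p : V -> 'rV[R]_D) :
  rigidity_mx G p = bar_mx G (fun x y i => (p x - p y) 0 i).
Proof. by []. Qed.

Let label_gt0 (eps : R) v : 0 < eps -> 0 < 1 + eps * label v.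
Proof. by move=> e0; rewrite ltr_wpDr ?mulr_ge0 ?ler0n ?ltW. Qed.

Lemma placement_inj eps : 0 < eps -> injective (placement eps).
Proof.
move=> e0 x y /rowP exy; have := exy (f x); rewrite !mxE eqxx mulr1.
case: eqP => [_|_]; last by move/eqP; rewrite mulr0 gt_eqF ?label_gt0.
rewrite mulr1 => /addrI /(mulfI (lt0r_neq0 e0)) /eqP.
by rewrite eqr_nat => /eqP/val_inj/enum_rank_inj.
Qed.

(** Scaling the rows inside a class by [eps] does not change the kernel. *)
Lemma rigidity_rank_ge eps : 0 < eps ->
  (forall u : 'cV[R]_N, bar_mx G (bar eps label) *m u = 0 -> test_mx R *m u = 0 -> u = 0) ->
  (N <= \rank (rigidity_mx G (placement eps)) + #|{: pairs}|)%N.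
Proof.
move=> e0 inj; apply: rank_of_tests (test_mx R) _ => u ru; apply: inj.
rewrite rigidity_mxE in ru; apply/bar_mx_kernel => x y xy.
have /bar_mx_kernel/(_ x y xy) := ru.
rewrite /bar eq_sym [f y == f x]eq_sym; case: eqP => [fxy|_] h.
  apply: (mulfI (lt0r_neq0 e0)); rewrite mulr0 -[RHS]h mulr_sumr.
  by apply: eq_bigr => i _; rewrite !mxE fxy; ring.
by rewrite -[RHS]h; apply: eq_bigr => i _; rewrite !mxE.
Qed.

(* The columns are the infinitesimal isometries of [R^D]: translations for
   [i = j], rotations in the [(i, j)]-plane for [i < j]. *)
Definition isometries (p : V -> 'rV[R]_D) : 'M[R]_(N, #|{: pairs}|) :=
  \matrix_(b, k) let: (w, l) := enum_val b : V * 'I_D in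
    let: (i, j) := val (enum_val k) : 'I_D * 'I_D in
    if i == j then (l == i)%:R else (l == i)%:R * p w 0 j - (l == j)%:R * p w 0 i.

(** A rotation moves the ends of a bar with relative velocity an antisymmetric image of [p x - p y],
    hence orthogonal to the bar. *)
Lemma rigidity_isometries p : rigidity_mx G p *m isometries p = 0.
Proof.
suff ker k : rigidity_mx G p *m col k (isometries p) = 0.
  apply/matrixP => a k; have /matrixP/(_ a 0) := ker k.
  by rewrite colE mulmxA -colE !mxE.
rewrite rigidity_mxE; apply/bar_mx_kernel => x y _.
rewrite /motion; under eq_bigr => l _ do rewrite !mxE !enum_rankK.
case: (val _) => i j /=; case: eqP => _.
  by rewrite big1 // => l _; ring.
pose z l := p x 0 l - p y 0 l.
transitivity (\sum_l (l == i)%:R * (z l * z j) - \sum_l (l == j)%:R * (z l * z i)).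
  by rewrite -sumrB; apply: eq_bigr => l _; rewrite /z; ring.
by rewrite !sum_pick mulrC subrr.
Qed.

(** The system is triangular: [rep i] lies on axis [i], so its coordinate [i] sees only the
    translation [(i, i)], and its coordinate [j > i] only the translation [(j, j)] and the rotation
    [(i, j)]. *)
Lemma isometries_rank eps : 0 < eps -> \rank (isometries (placement eps)) = #|{: pairs}|.
Proof.
move=> e0; apply: col_inj_rank => u iu.
have row_eq (i j : 'I_D) : \sum_(k : pairs) isometries (placement eps) (enum_rank (rep i, j)) (enum_rank k)
    * u (enum_rank k) 0 = 0.
  have /matrixP/(_ (enum_rank (rep i, j)) 0) := iu; rewrite [LHS]mxE [RHS]mxE.
  rewrite (reindex enum_rank) //=.
  by exists enum_val => k _; rewrite ?enum_rankK ?enum_valK.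
have entry (i j : 'I_D) (k : pairs) :
    isometries (placement eps) (enum_rank (rep i, j)) (enum_rank k) =
    if (val k).1 == (val k).2 then (j == (val k).1)%:R else
      (j == (val k).1)%:R * ((1 + eps * label (rep i)) * ((val k).2 == i)%:R)
      - (j == (val k).2)%:R * ((1 + eps * label (rep i)) * ((val k).1 == i)%:R).
  by rewrite !mxE !enum_rankK; case: (val k) => a b /=; rewrite !mxE f_rep.
have diag (i : 'I_D) : u (enum_rank (Sub (i, i) (leqnn i) : pairs)) 0 = 0.
  have := row_eq i i; rewrite (bigD1 (Sub (i, i) (leqnn i))) //= big1 ?addr0.
    by rewrite entry /= !eqxx mul1r.
  move=> k; rewrite entry -val_eqE /=; case: (val k) => a b /=.
  rewrite xpair_eqE [i == a]eq_sym [i == b]eq_sym; case: (eqVneq a b) => [-> |nab].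
    by rewrite andbb => /negPf->; rewrite mul0r.
  move=> _; case: (eqVneq a i) nab => [->|]; case: (eqVneq b i) => //= *;
    by rewrite ?eqxx // !(mulr0, mul0r, subrr).
apply/matrixP => k o; rewrite ord1 [RHS]mxE -[k]enum_valK.
case: (enum_val k) => -[i j] ij; have ijn : (i <= j)%N := ij.
have [e|nij] := eqVneq i j.
  by rewrite -(diag i); congr (u (enum_rank _) 0); apply: val_inj; rewrite /= e.
have := row_eq i j; rewrite (bigD1 (Sub (i, j) ij)) //= big1 ?addr0.
  rewrite entry /= (negPf nij) !eqxx eq_sym (negPf nij) mul0r sub0r mul1r mulr1 mulNr.
  move/eqP; rewrite oppr_eq0 mulf_eq0 gt_eqF ?label_gt0 //= => /eqP <-.
  by congr (u (enum_rank _) 0); apply: val_inj.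
move=> k' nk; have [e|nab] := eqVneq (val k').1 (val k').2.
  have -> : k' = Sub ((val k').1, (val k').1) (leqnn _).
    by apply: val_inj; rewrite /= {2}e -surjective_pairing.
  by rewrite diag mulr0.
rewrite entry (negPf nab); move: nk nab (valP k'); rewrite -val_eqE /=.
case: (val k') => a b /=; rewrite /upper xpair_eqE /= => nk nab ab.
suff -> : (j == a)%:R * ((1 + eps * label (rep i)) * (b == i)%:R)
    - (j == b)%:R * ((1 + eps * label (rep i)) * (a == i)%:R) = 0 :> R by rewrite mul0r.
have -> : (j == b)%:R * ((1 + eps * label (rep i)) * (a == i)%:R) = 0 :> R.
  move: nk; rewrite [b == j]eq_sym; case: (a == i); case: (j == b) => //= _; rewrite ?mul0r ?mulr0 //.
have -> : (j == a)%:R * ((1 + eps * label (rep i)) * (b == i)%:R) = 0 :> R.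
  case: eqP => [ja|_]; case: eqP => [bi|_]; rewrite ?mul0r ?mulr0 //.
  by move: nij; rewrite -val_eqE eqn_leq ijn ja -bi ab.
by rewrite subrr.
Qed.

End StrongPartitionRigid.

Theorem strong_partition_rigid (R : realType) (V : finType) (G : sgraph V) D (f : V -> 'I_D) :
  strong_rigid_partition G f -> (D < #|V|)%N -> rigid R D G.
Proof.
move=> f_strong DV; split=> //.
have [rep f_rep] := fin_all_exists f_strong.1.
have [eps e0 inj] := bar_mx_inj R f_strong f_rep.
exists (placement f eps); split; first exact: placement_inj.
have := rigidity_rank_ge e0 inj.
have := mulmx0_rank_max (rigidity_isometries G (placement f eps)).
rewrite (isometries_rank f_rep e0) card_upper.
move: (\rank (rigidity_mx G _)) => r; rewrite card_prod card_ord mulnC => le ge.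
by apply/eqP; rewrite eqn_leq leq_subLR addnC ge andbT leq_subRL ?(leq_trans _ le) ?leq_addl // addnC.
Qed.

(** * Numerical bounds *)

Lemma half_le_ln2 (R : realType) : 1 / 2 <= ln (2 : R).
Proof.
have : ln (1 + - (1 / 2) : R) <= - (1 / 2) by apply: le_ln1Dx; lra.
have -> : 1 + - (1 / 2) = 2^-1 :> R by field.
by rewrite lnV ?posrE //; lra.
Qed.

Lemma trunc_log_le_ln (R : realType) n : (0 < n)%N -> (trunc_log 2 n)%:R / 2 <= ln (n%:R : R).
Proof.
move=> n0; have h : (2 ^ trunc_log 2 n)%:R <= n%:R :> R by rewrite ler_nat trunc_logP.
apply: le_trans (_ : ln (2 ^ trunc_log 2 n)%:R <= _); last first.
  by rewrite ler_ln ?posrE ?ltr0n ?expn_gt0.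
rewrite natrX lnXn // -[ln _ *+ _]mulr_natl; apply: ler_wpM2l => //.
by have := half_le_ln2 R; rewrite div1r.
Qed.

(** For [n = 0] and [n = 1] the right side is zero, the latter because division by zero yields
    zero. *)
Lemma card_gt1_of_log_bound (R : realType) (c : R) n d :
  d%:R < c * Num.sqrt (n%:R : R) / ln (n%:R : R) -> (1 < n)%N.
Proof.
case: n => [|[|//]]; last by rewrite ln1 invr0 mulr0 ltrn0.
by rewrite sqrtr0 mulr0 mul0r ltrn0.
Qed.

(** With [l] the truncated logarithm, [4 * n ^ 3 < 2 ^ L] since [n < 2 ^ l.+1]. As [L <= 8 * l],
    [d.+1 <= 2 * d] and [200 <= 15 ^ 2], the second bound follows from [240 * d * l <= sqrt n], and
    [1 / 500] gives [250 * d * l < sqrt n]. *)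
Lemma log_bounds (R : realType) n d : (0 < d)%N ->
  d%:R < 1 / 500 * Num.sqrt (n%:R : R) / ln (n%:R : R) ->
  let L := (3 * (trunc_log 2 n).+1 + 2)%N in
  (4 * n ^ 2 * d.+1 < 2 ^ L)%N /\ (200 * (d.+1 * L) ^ 2 <= n)%N.
Proof.
move=> d0 hd; set l := trunc_log 2 n => L.
have n1 := card_gt1_of_log_bound hd; have n0 : (0 < n)%N by lia.
have l0 : (0 < l)%N by apply: trunc_log_max.
have hl := trunc_log_le_ln R n0; rewrite -/l in hl.
have l0R : 0 < l%:R :> R by rewrite ltr0n.
have ln0 : 0 < ln (n%:R : R) by apply: lt_le_trans hl; rewrite divr_gt0.
have dl : d%:R * (l%:R / 2) < 1 / 500 * Num.sqrt n%:R :> R.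
  by apply: le_lt_trans (_ : d%:R * ln n%:R < _); rewrite ?ler_wpM2l // -ltr_pdivlMr.
have sq : (Num.sqrt n%:R) ^+ 2 = n%:R :> R by rewrite sqr_sqrtr.
have s0 := sqrtr_ge0 (n%:R : R).
have dl2 : ((15 * (16 * (d * l))) ^ 2 <= n)%N.
  rewrite -(ler_nat R) natrX !natrM -sq.
  have h : 15 * (16 * (d%:R * l%:R)) <= Num.sqrt n%:R :> R by lra.
  by rewrite ler_pXn2r ?nnegrE ?mulr_ge0.
have big : (200 * (d.+1 * L) ^ 2 <= n)%N.
  apply: leq_trans dl2; apply: (@leq_trans (200 * (2 * d * (8 * l)) ^ 2)%N).
    by rewrite leq_mul2l /= leq_exp2r // leq_mul /L //; lia.
  have -> : (2 * d * (8 * l) = 16 * (d * l))%N by lia.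
  by rewrite (expnMn 15) leq_mul2r orbT.
split=> //; have dn : (d.+1 <= n)%N.
  by apply: leq_trans big; rewrite /L; nia.
have : (n < 2 ^ l.+1)%N by apply: trunc_log_ltn.
rewrite /L expnD mulnC expnM => hn.
have : (n ^ 3 < (2 ^ 3) ^ l.+1)%N by rewrite -expnM mulnC expnM ltn_exp2r.
have : (4 * n ^ 2 * d.+1 <= 4 * n ^ 3)%N by rewrite (expnSr n 2) mulnA leq_mul2l dn orbT.
by rewrite mulnC; lia.
Qed.

Theorem theorem1p15 (R : realType) :
  exists c : R, 0 < c /\
    forall (n d : nat) (V : finType) (G : sgraph V),
      #|V| = n ->
      d%:R < c * Num.sqrt (n%:R : R) / ln (n%:R : R) ->
      (n%:R / 2 + d%:R : R) <= (min_degree G)%:R ->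
      rigid R d.+1 G.
Proof.
exists (1 / 500); split; first by lra.
move=> n d V G cardV hd hdeg.
have n1 := card_gt1_of_log_bound hd.
have deg v : (n + 2 * d <= 2 * #|nbrs G v|)%N.
  apply: (@leq_trans (2 * min_degree G)); last by rewrite leq_mul2l min_degree_le.
  by rewrite -(ler_nat R) natrD !natrM; lra.
case: (posnP d) hd deg hdeg => [->|d0] hd deg _.
  apply: (@strong_partition_rigid R V G 1 (fun=> ord0)); last by rewrite cardV.
  by apply: dense_partition1 => [|v]; rewrite cardV; [lia|have := deg v; lia].
have [L_large n_large] := log_bounds d0 hd.
have [|f f_strong] := dense_partition cardV _ L_large n_large deg; first by lia.
apply: strong_partition_rigid f_strong _; rewrite cardV.
by apply: leq_trans n_large; nia.
Qed.
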